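(* Let $R$ be a ring with identity and let $a_1,a_2,d_1,d_2\in R$ be such that $a_1^{\parallel d_1}$ and $a_2^{\parallel d_2}$ exist. If there exists $d_3\in R$ such that $d_2d_1R=d_3R$ and $Rd_2d_1=Rd_3$, and if $a_1^{\parallel d_1}a_1$ commutes with $a_2d_2$ and $a_2a_2^{\parallel d_2}$ commutes with $d_1a_1$, then $a_1a_2$ is invertible along $d_3$ and $$(a_1a_2)^{\parallel d_3}=a_2^{\parallel d_2}a_1^{\parallel d_1}.$$
   Context: Rings are associative with identity, not necessarily commutative. For $x\in R$, $xR=\{xr: r\in R\}$ and $Rx=\{rx: r\in R\}$. An element $a\in R$ is said to be invertible along $d\in R$ (Mary invertible) if there exists $y\in R$ such that $yad=d=day$, $yR\subseteq dR$ and $Ry\subseteq Rd$. Such a $y$ is unique when it exists and is denoted $a^{\parallel d}$. *)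

(* Defs.v *)
From HB Require Import structures.
From mathcomp Require Import all_boot all_order all_algebra.
From mathcomp Require Import boolp classical_sets.

Set Implicit Arguments.
Unset Strict Implicit.
Unset Printing Implicit Defensive.

Import GRing.Theory.
Local Open Scope classical_set_scope.
Local Open Scope ring_scope.

Definition right_mult (R : pzRingType) (x : R) : set R := [set x * r | r in setT].

Definition left_mult (R : pzRingType) (x : R) : set R := [set r * x | r in setT].

Definition is_mary_inverse (R : pzRingType) (a d y : R) : Prop :=
  [/\ y * a * d = d, d * a * y = d,
      right_mult y `<=` right_mult d & left_mult y `<=` left_mult d].

Definition mary_invertible (R : pzRingType) (a d : R) : Prop :=
  exists y : R, is_mary_inverse a d y.

(* The value is 0 when a is not invertible along d. *)
Definition mary_inv (R : pzRingType) (a d : R) : R :=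
  xget 0 [set y : R | is_mary_inverse a d y].

Lemma is_mary_inverse_uniq (R : pzRingType) (a d y z : R) :
  is_mary_inverse a d y -> is_mary_inverse a d z -> y = z.
Proof.
move=> [_ day yd _] [zad _ _ zd].
have [u _ yE] : right_mult d y by apply: yd; exists 1; rewrite ?mulr1.
have [v _ zE] : left_mult d z by apply: zd; exists 1; rewrite ?mul1r.
have <- : z * a * y = y by rewrite -yE mulrA zad.
by rewrite -zE -!mulrA (mulrA d) day.
Qed.

Lemma mary_invP (R : pzRingType) (a d : R) :
  mary_invertible a d -> is_mary_inverse a d (mary_inv a d).
Proof. by move=> [y ady]; apply: (xgetPex 0); exists y. Qed.

Lemma mary_invE (R : pzRingType) (a d y : R) :
  is_mary_inverse a d y -> mary_inv a d = y.
Proof.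
move=> ady; apply: is_mary_inverse_uniq (ady).
by apply: mary_invP; exists y.
Qed.

(* Main.v *)
(* For b the inverse of a along d, b = d (ad)^# = (da)^# d, with x^# the group
   inverse, which commutes with everything commuting with x.  Writing b1, b2
   for the two inverses, this moves b1 a1 past (a2 d2)^# and a2 b2 past
   (d1 a1)^# to give b2 b1 in d2 b1 R = d2 d1 R and in R b2 d1 = R d2 d1; the
   two equations follow from the commutations directly. *)
Require Import Defs.
From HB Require Import structures.
From mathcomp Require Import all_boot all_order all_algebra.
From mathcomp Require Import boolp classical_sets.
Import GRing.Theory.
Local Open Scope classical_set_scope.
Local Open Scope ring_scope.

Section MaryInverse.
Variable R : pzRingType.
Implicit Types a b d e s u w x y : R.

Lemma right_multP x y :
  right_mult x `<=` right_mult y <-> exists u, x = y * u.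
Proof.
split=> [xy|[u ->] _ [r _ <-]]; last by exists (u * r); rewrite ?mulrA.
by have [|u _ <-] := xy x; [exists 1; rewrite ?mulr1 | exists u].
Qed.

Lemma left_multP x y :
  left_mult x `<=` left_mult y <-> exists u, x = u * y.
Proof.
split=> [xy|[u ->] _ [r _ <-]]; last by exists (r * u); rewrite ?mulrA.
by have [|u _ <-] := xy x; [exists 1; rewrite ?mul1r | exists u].
Qed.

(* Under these hypotheses [w * x * s] is the group inverse of [x]. *)
Lemma comm_group_inverse x w s e :
  x = w * x * x -> x = x * x * s -> GRing.comm e x ->
  GRing.comm e (w * x * s).
Proof.
move=> xw xs ex.
have wx_xs : w * x = x * s by rewrite {1}xs !mulrA -xw.
have exx : e * (x * x) = x * x * e by rewrite mulrA ex -mulrA ex mulrA.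
(* The idempotent [x * s] absorbs [e] from either side: [w x e = w e x = w e x x s = w x x e s = x e
   s]. *)
have e_xs : e * (x * s) = x * s * e.
  rewrite -{2}wx_xs mulrA ex -[RHS]mulrA -ex [X in _ = w * (e * X)]xs.
  by rewrite (mulrA e) exx !mulrA -xw ex.
rewrite /GRing.comm.
have -> : w * x * s * e = w * (e * (x * s)) by rewrite e_xs !mulrA.
have -> : w * (e * (x * s)) = w * x * e * s by rewrite !mulrA -(mulrA w e) ex !mulrA.
by rewrite wx_xs -e_xs !mulrA.
Qed.

(** [g] is the group inverse of [a * d], which exists because [d = d a d s] and [d = t d a d] put
    [a * d] in both one-sided ideals of its square. As [g = a d s s], [d g = d s = b]. *)
Lemma mary_inverse_right_factor a d b : is_mary_inverse a d b ->
  exists2 g, b = d * g & forall e, GRing.comm e (a * d) -> GRing.comm e g.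
Proof.
move=> [bad dab /right_multP[s bs] /left_multP[t bt]].
have ds : d * a * d * s = d by rewrite -mulrA -bs.
have dt : t * d * a * d = d by rewrite -bt.
(* Chosen so that two uses of [d = t d a d] collapse [w (a d) (a d)] to [a d]. *)
pose w := a * t * t * d.
have xw : a * d = w * (a * d) * (a * d).
  by rewrite /w -{1}dt -{1}dt !mulrA.
have xs : a * d = a * d * (a * d) * s by rewrite -{1}ds !mulrA.
exists (w * (a * d) * s); last by move=> e; apply: comm_group_inverse.
have -> : w * (a * d) = a * d * s by rewrite {1}xs !mulrA -(mulrA w) -(mulrA (w * _)) -xw.
by rewrite !mulrA ds.
Qed.

(** Mirror image, with [g] the group inverse of [d * a]: here [g d = t t d a d = t d = b]. *)
Lemma mary_inverse_left_factor a d b : is_mary_inverse a d b ->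
  exists2 g, b = g * d & forall e, GRing.comm e (d * a) -> GRing.comm e g.
Proof.
move=> [bad dab /right_multP[s bs] /left_multP[t bt]].
have ds : d * a * d * s = d by rewrite -mulrA -bs.
have dt : t * d * a * d = d by rewrite -bt.
pose w := d * s * s * a.
have xw : d * a = d * a * (d * a) * w.
  by rewrite /w !mulrA; congr (_ * a); rewrite -[LHS]ds -{2}ds !mulrA.
have xt : d * a = t * (d * a) * (d * a) by rewrite -{1}dt !mulrA.
exists (t * (d * a) * w); last by move=> e; apply: comm_group_inverse.
have -> : t * (d * a) * w = t * (t * (d * a * (d * a) * w)).
  by rewrite {1}xt !mulrA.
have -> : t * (t * (d * a * (d * a) * w)) * d = t * (t * d * a * d).
  by rewrite -xw !mulrA.
by rewrite dt.
Qed.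

Lemma is_mary_inverse_mul a1 a2 d1 d2 d3 b1 b2 :
  is_mary_inverse a1 d1 b1 -> is_mary_inverse a2 d2 b2 ->
  right_mult (d2 * d1) = right_mult d3 ->
  left_mult (d2 * d1) = left_mult d3 ->
  GRing.comm (b1 * a1) (a2 * d2) -> GRing.comm (a2 * b2) (d1 * a1) ->
  is_mary_inverse (a1 * a2) d3 (b2 * b1).
Proof.
move=> inv1 inv2 d3r d3l comm1 comm2.
have [g2 b2E g2C] := mary_inverse_right_factor _ _ _ inv2.
have [g1 b1E g1C] := mary_inverse_left_factor _ _ _ inv1.
case: inv1 inv2 => [b1ad dab1 /right_multP[s1 b1s] _].
case=> [b2ad dab2 _ /left_multP[t2 b2t]].
(* Writing [d3] with [d2 d1] on the left or on the right reduces each equation to one about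
   [d2 d1]. *)
have [q d3q] : exists q, d3 = d2 * d1 * q by apply/right_multP; rewrite d3r.
have [p d3p] : exists p, d3 = p * (d2 * d1) by apply/left_multP; rewrite d3l.
have b1ab : b1 * a1 * b1 = b1 by rewrite {2}b1s mulrA b1ad -b1s.
have b2ab : b2 * a2 * b2 = b2.
  by rewrite {1}b2t -!mulrA (mulrA d2) dab2 -b2t.
split; last 2 first.
(* [b2 b1 = d2 g2 (b1 a1) b1 = d2 (b1 a1) g2 b1], and [b1 = d1 s1] brings out [d2 d1]. *)
- rewrite -d3r; apply/right_multP; exists (s1 * a1 * g2 * b1).
  rewrite -{1}b1ab {1}b2E -mulrA (mulrA g2) -(g2C _ comm1) {1}b1s.
  by rewrite !mulrA.
(* Dually, [b2 b1 = b2 (a2 b2) g1 d1 = b2 g1 (a2 b2) d1], and [b2 = t2 d2]. *)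
- rewrite -d3l; apply/left_multP; exists (b2 * g1 * a2 * t2).
  rewrite -{1}b2ab -(mulrA b2 a2) {1}b1E -mulrA (mulrA (a2 * b2)).
  by rewrite (g1C _ comm2) {2}b2t !mulrA.
(* Swapping [b1 a1] with [a2 d2] leaves [(b2 a2 d2) (b1 a1 d1) q = d2 d1 q]. *)
- have -> : b2 * b1 * (a1 * a2) * d3 = b2 * (b1 * a1 * (a2 * d2)) * d1 * q.
    by rewrite d3q !mulrA.
  by rewrite comm1 !mulrA b2ad -!(mulrA d2) b1ad mulrA -d3q.
- have -> : d3 * (a1 * a2) * (b2 * b1) = p * d2 * (d1 * a1 * (a2 * b2)) * b1.
    by rewrite d3p !mulrA.
  have -> : p * d2 * (d1 * a1 * (a2 * b2)) * b1
          = p * (d2 * a2 * b2 * (d1 * a1 * b1)) by rewrite -comm2 !mulrA.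
  by rewrite dab2 dab1 -d3p.
Qed.

End MaryInverse.

Theorem corollary2p25 (R : pzRingType) (a1 a2 d1 d2 : R)
    (inv1 : mary_invertible a1 d1) (inv2 : mary_invertible a2 d2)
    (d3 : R)
    (d3r : right_mult (d2 * d1) = right_mult d3)
    (d3l : left_mult (d2 * d1) = left_mult d3)
    (comm1 : GRing.comm (mary_inv a1 d1 * a1) (a2 * d2))
    (comm2 : GRing.comm (a2 * mary_inv a2 d2) (d1 * a1)) :
  mary_invertible (a1 * a2) d3 /\
  mary_inv (a1 * a2) d3 = mary_inv a2 d2 * mary_inv a1 d1.
Proof.
have b12 := is_mary_inverse_mul _ _ _ _ _ _ _ _ (mary_invP inv1) (mary_invP inv2)
  d3r d3l comm1 comm2.
by split; [eexists; exact: b12 | exact: mary_invE].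
Qed.
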